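(* Let $S\subset\mathbb{R}^p$ be a compact set with $\mathrm{cl}(\mathrm{int}(S))=S$, and let $\mu_S$ be the uniform probability measure on $S$. Let $(\delta_k)_{k\in\mathbb{N}}$ be a decreasing sequence of positive numbers converging to $0$. For every $k$, let $d_k$ be the smallest positive integer such that \[2^{3-\frac{\delta_k d_k}{\delta_k+\mathrm{diam}(S)}}\,d_k^p\left(\frac{e}{p}\right)^p\exp\left(\frac{p^2}{d_k}\right)\le\alpha_k,\qquad\text{where}\quad \alpha_k:=\frac{\delta_k^p\,\omega_p}{\lambda(S)}\,\frac{(d_k+1)(d_k+2)(d_k+3)}{(d_k+p+1)(d_k+p+2)(2d_k+p+6)}.\] For every $k$ let $S_k=\{\mathbf{x}\in\mathbb{R}^p:\ s(d_k)\,\Lambda_{\mu_S,d_k}(\mathbf{x})\ge\alpha_k\}$. Then, as $k\to\infty$, $d_H(S_k,S)\to0$ and $d_H(\partial S_k,\partial S)\to0$.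
   Context: $\lambda$ is Lebesgue measure on $\mathbb{R}^p$, and $\mu_S=\lambda_S/\lambda(S)$ where $\lambda_S$ is the restriction of $\lambda$ to $S$. $\mathrm{diam}(S)$ is the diameter of $S$, $\omega_p=\frac{2\pi^{(p+1)/2}}{\Gamma((p+1)/2)}$, and $s(d)=\binom{p+d}{d}$. For a finite Borel measure $\nu$ on $\mathbb{R}^p$ with finite moments and $d\in\mathbb{N}$, the Christoffel function is $\Lambda_{\nu,d}(\xi)=\min\{\int P^2\,d\nu: P\in\mathbb{R}[X]_d,\ P(\xi)=1\}$, where $\mathbb{R}[X]_d$ is the space of real polynomials in $p$ variables of total degree at most $d$ (equivalently $\Lambda_{\nu,d}(\xi)=(\mathbf{v}_d(\xi)^T\mathbf{M}_d(\nu)^{-1}\mathbf{v}_d(\xi))^{-1}$ when the moment matrix $\mathbf{M}_d(\nu)=\int\mathbf{v}_d\mathbf{v}_d^T d\nu$ of the monomial vector $\mathbf{v}_d$ is invertible). $\partial A$ is the topological boundary of $A$, and $d_H(X,Y)=\max\{\sup_{\mathbf{x}\in X}\inf_{\mathbf{y}\in Y}\|\mathbf{x}-\mathbf{y}\|,\ \sup_{\mathbf{y}\in Y}\inf_{\mathbf{x}\in X}\|\mathbf{x}-\mathbf{y}\|\}$ is the Hausdorff distance. *)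

(* Defs.v *)
From HB Require Import structures.
From mathcomp Require Import all_boot all_order all_algebra.
From mathcomp Require Import all_classical all_reals all_analysis.
Set Implicit Arguments. Unset Strict Implicit. Unset Printing Implicit Defensive.
Import Order.TTheory GRing.Theory Num.Theory.
Import numFieldNormedType.Exports.
Local Open Scope classical_set_scope.
Local Open Scope ring_scope.

(* product of two sigma-finite measures, packaged as a sigma-finite measure
   (the library declares this instance, but it is shadowed by the
   subprobability instance for canonical inference) *)
Section P.
Local Open Scope ereal_scope.
Context d1 d2 (T1 : measurableType d1) (T2 : measurableType d2) (R : realType).
Variable m1 : {sigma_finite_measure set T1 -> \bar R}.
Variable m2 : {sigma_finite_measure set T2 -> \bar R}.
Definition prodm : set (T1 * T2) -> \bar R := (m1 \x m2).
HB.instance Definition _ := Measure.on prodm.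
Lemma prodm_sigma_finite : sigma_finite setT prodm.
Proof.
have /sigma_finiteP[F [TF ndF Foo]] := sigma_finiteT m1.
have /sigma_finiteP[G [TG ndG Goo]] := sigma_finiteT m2.
exists (fun n => F n `*` G n).
 rewrite -setXTT TF TG predeqE => -[x y]; split.
    move=> [/= [n _ Fnx] [k _ Gky]]; exists (maxn n k) => //; split.
    - by move: x Fnx; exact/subsetPset/ndF/leq_maxl.
    - by move: y Gky; exact/subsetPset/ndG/leq_maxr.
  by move=> [n _ []/= ? ?]; split; exists n.
move=> k; have [? ?] := Foo k; have [? ?] := Goo k.
split; first exact: measurableX.
by rewrite /prodm product_measure1E// lte_mul_pinfty// ge0_fin_numE.
Qed.
HB.instance Definition _ := Measure_isSigmaFinite.Build _ _ _ prodm prodm_sigma_finite.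
End P.

Section Defs.
Variable R : realType.

(* Lebesgue measure on R^n, built as the iterated product measure
   (((pt x R) x R) x ... x R) of one-dimensional Lebesgue measures. *)
Record lebspace := LebSpace {
  ls_d : measure_display;
  ls_T : measurableType ls_d;
  ls_m : {sigma_finite_measure set ls_T -> \bar R} }.

Fixpoint leb_space (n : nat) : lebspace :=
  match n with
  | 0 => @LebSpace _ unit (@dirac _ unit tt R)
  | m.+1 => let L := leb_space m in
      @LebSpace _ (ls_T L * measurableTypeR R)%type (@prodm _ _ _ _ R (ls_m L) (@lebesgue_measure R))
  end.

Fixpoint coord (n : nat) : ls_T (leb_space n) -> 'rV[R]_n :=
  match n return ls_T (leb_space n) -> 'rV[R]_n with
  | 0 => fun _ => 0
  | m.+1 => fun y => \row_(i < m.+1)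
      match unlift ord_max i with
      | Some j => coord y.1 ord0 j
      | None => y.2
      end
  end.

Definition leb (n : nat) (A : set 'rV[R]_n) : \bar R :=
  ls_m (leb_space n) (@coord n @^-1` A).

Definition unif_int (n : nat) (S : set 'rV[R]_n) (f : 'rV[R]_n -> R) : \bar R :=
  ((\int[ls_m (leb_space n)]_(y in @coord n @^-1` S) (f (@coord n y))%:E) *
   ((fine (leb S))^-1)%:E)%E.

Definition eucl (n : nat) (x : 'rV[R]_n) : R :=
  Num.sqrt (\sum_(i < n) x ord0 i ^+ 2).

Definition diam (n : nat) (S : set 'rV[R]_n) : R :=
  sup [set eucl (x - y) | x in S & y in S].

Definition hausdorff (n : nat) (X Y : set 'rV[R]_n) : \bar R :=
  Order.max
    (ereal_sup [set ereal_inf [set (eucl (x - y))%:E | y in Y] | x in X])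
    (ereal_sup [set ereal_inf [set (eucl (x - y))%:E | x in X] | y in Y]).

Definition bdry (n : nat) (A : set 'rV[R]_n) : set 'rV[R]_n :=
  closure A `\` interior A.

(* polynomials of total degree <= d in n variables: coefficient families
   indexed by exponent vectors alpha with |alpha| <= d *)
Definition exps (n d : nat) := {ffun 'I_n -> 'I_d.+1}.

Definition peval (n d : nat) (c : {ffun exps n d -> R}) (x : 'rV[R]_n) : R :=
  \sum_(a : exps n d | (\sum_(i < n) (a i : nat) <= d)%N)
     c a * \prod_(i < n) x ord0 i ^+ a i.

(* Christoffel function Lambda_{nu,d}(xi) = inf { int P^2 dnu : deg P <= d, P(xi) = 1 },
   nu given through its integration functional *)
Definition christoffel (n : nat) (nu_int : ('rV[R]_n -> R) -> \bar R) (d : nat)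
    (xi : 'rV[R]_n) : \bar R :=
  ereal_inf [set nu_int (fun x => (peval c x) ^+ 2) |
             c in [set c : {ffun exps n d -> R} | peval c xi = 1]].

Definition Gamma (s : R) : R :=
  fine (\int[@lebesgue_measure R]_(t in `]0%R, +oo[%classic)
          (powR t (s - 1) * expR (- t))%:E).

Definition omega (p : nat) : R :=
  2 * powR pi ((p%:R + 1) / 2) / Gamma ((p%:R + 1) / 2).

Definition alpha (p : nat) (S : set 'rV[R]_p) (delta : R) (d : nat) : R :=
  delta ^+ p * omega p / fine (leb S) *
  ((d%:R + 1) * (d%:R + 2) * (d%:R + 3) /
   ((d%:R + p%:R + 1) * (d%:R + p%:R + 2) * (2 * d%:R + p%:R + 6))).

Definition dlhs (p : nat) (S : set 'rV[R]_p) (delta : R) (d : nat) : R :=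
  powR 2 (3 - delta * d%:R / (delta + diam S)) * d%:R ^+ p *
  (expR 1 / p%:R) ^+ p * expR (p%:R ^+ 2 / d%:R).

End Defs.

(* Main.v *)
Require Import Defs.
From HB Require Import structures.
From mathcomp Require Import all_boot all_order all_algebra.
From mathcomp Require Import all_classical all_reals all_analysis.
From mathcomp Require Import ring lra measurable_realfun.
Set Implicit Arguments. Unset Strict Implicit. Unset Printing Implicit Defensive.
Import Order.TTheory GRing.Theory Num.Theory.
Import numFieldNormedType.Exports.
Local Open Scope classical_set_scope.
Local Open Scope ring_scope.

(**
Since [delta k] tends to [0], crude bounds on the Christoffel function at a fixed
distance [e] from the boundary suffice.

- Inside: a polynomial [q] of degree at most [d] in one variable satisfies
  [q(z)^2 <= (d + 1) / (2 e) * int_(z - e)^(z + e) q^2]. Integrating one coordinate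
  at a time gives [s(d) * Lambda_d(y) >= e^p / (p! * leb S)] whenever [S] contains the
  cube of half-side [e] around [y], whereas [alpha_k] is [O((delta k)^p)].
- Outside: a power of [1 - |y - z|^2 / const] is a competitor showing that
  [Lambda_d(z)] decays geometrically in [d], uniformly in the [z] at distance at least
  [e] from [S]. The condition [dlhs <= alpha] forces [d k] to tend to infinity and
  [alpha_k] to decay at most like [2^(- o(1) * d k)].

Hence, for [k] large, [S_k] contains the points [e]-deep in [S] and avoids those
[e]-far from [S]. The convergence of the sets and of their boundaries then follows by
compactness and because a segment from [A] to its complement meets the boundary of [A].
The condition [dlhs <= alpha] also yields [0 < leb S < +oo] and [0 < omega], as [alpha]
would otherwise be nonpositive.
*)

Section altsum.
Variable R : realType.
Implicit Types (u : nat -> R) (g p q : {poly R}).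

Definition altsum (m : nat) u : R :=
  \sum_(i < m.+1) (-1) ^+ i * 'C(m, i)%:R * u i.

Lemma altsumS m u : altsum m.+1 u = altsum m u - altsum m (fun i => u i.+1).
Proof.
rewrite /altsum big_ord_recl /= bin0 expr0 !mul1r.
under eq_bigr => i _.
  rewrite /bump /= add1n binS natrD exprS.
  rewrite (_ : _ * u i.+1 = - ((-1) ^+ i * 'C(m, i)%:R * u i.+1) +
     (- ((-1) ^+ i * 'C(m, i.+1)%:R * u i.+1))); last by ring.
  over.
rewrite big_split /= !sumrN addrA addrAC; congr (_ - _).
rewrite big_ord_recr /= bin_small // mulr0 mul0r addr0.
rewrite [RHS]big_ord_recl /= bin0 expr0 !mul1r -sumrN; congr (_ + _).
by apply: eq_bigr => i _; rewrite /bump /= add1n exprS; ring.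
Qed.

Lemma eq_altsum m u v : (forall i, (i <= m)%N -> u i = v i) ->
  altsum m u = altsum m v.
Proof.
by move=> uv; apply: eq_bigr => i _; rewrite uv // -ltnS ltn_ord.
Qed.

Lemma altsumZ m a u : altsum m (fun i => a * u i) = a * altsum m u.
Proof. by rewrite /altsum mulr_sumr; apply: eq_bigr => i _; ring. Qed.

Lemma altsumD m u v : altsum m (fun i => u i + v i) = altsum m u + altsum m v.
Proof. by rewrite /altsum -big_split; apply: eq_bigr => i _; rewrite mulrDr. Qed.

Lemma size_shift_sub m g : (size g <= m.+1)%N ->
  (size (g - (g \Po ('X + 1%:P)))%R <= m)%N.
Proof.
move=> sg.
have s2 : size ('X + 1%:P : {poly R}) = 2%N.
  by rewrite size_polyDl ?size_polyX // size_polyC; case: (_ != 0).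
have lc : lead_coef ('X + 1%:P : {poly R}) = 1.
  by rewrite lead_coefDl ?lead_coefX // size_polyX size_polyC; case: (_ != 0).
have sc : size (g \Po ('X + 1%:P)) = size g by rewrite size_comp_poly2.
apply/leq_sizeP => j; rewrite leq_eqVlt => /predU1P[<-|mj]; rewrite coefB; last first.
  by rewrite !nth_default ?subrr // ?sc; exact: leq_trans mj.
move: sg; rewrite leq_eqVlt => /predU1P[sg|sg]; last first.
  by rewrite !nth_default ?subrr // ?sc.
have := lead_coef_comp g (q := 'X + 1%:P); rewrite s2 => /(_ isT).
rewrite lc expr1n mulr1 /lead_coef sc sg /= => ->.
by rewrite subrr.
Qed.

Lemma altsum_poly m g : (size g <= m)%N -> altsum m (fun i => g.[i%:R]) = 0.
Proof.
elim: m g => [|m IH] g sg.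
  move: sg; rewrite leqn0 size_poly_eq0 => /eqP ->.
  by rewrite /altsum big_ord1 horner0 mulr0.
rewrite altsumS -(IH _ (size_shift_sub sg)) -mulN1r -altsumZ -altsumD.
apply: eq_altsum => i _; rewrite hornerD hornerN horner_comp hornerD hornerX hornerC.
by rewrite -natr1; ring.
Qed.

Lemma altsum_inv m (x : R) : 0 < x ->
  altsum m (fun i => (i%:R + x)^-1) = m`!%:R / \prod_(i < m.+1) (i%:R + x).
Proof.
elim: m x => [|m IH] x x0.
  by rewrite /altsum !big_ord1 /= bin0 expr0 add0r fact0 !mul1r.
rewrite altsumS IH // (eq_altsum (v := fun i => (i%:R + (x + 1))^-1)); last first.
  by move=> i _; congr (_^-1); rewrite -natr1; ring.
rewrite IH ?addr_gt0 //.
have -> : \prod_(i < m.+1) (i%:R + x) = x * \prod_(i < m) (i%:R + (x + 1)).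
  rewrite big_ord_recl /= add0r; congr (_ * _); apply: eq_bigr => i _.
  by rewrite /bump /= add1n -natr1; ring.
have -> : \prod_(i < m.+2) (i%:R + x) =
    x * (\prod_(i < m) (i%:R + (x + 1)) * (m%:R + (x + 1))).
  transitivity (x * \prod_(i < m.+1) (i%:R + (x + 1))); last by rewrite big_ord_recr.
  rewrite big_ord_recl /= add0r; congr (_ * _).
  by apply: eq_bigr => i _; rewrite /bump /= add1n -natr1; ring.
rewrite big_ord_recr /= factS natrM.
have P0 : \prod_(i < m) (i%:R + (x + 1)) != 0.
  by apply/prodf_neq0 => i _; rewrite gt_eqF // ltr_wpDl // addr_gt0.
have m0 : m%:R + (x + 1) != 0 by rewrite gt_eqF // ltr_wpDl // addr_gt0.
rewrite -natr1; field.
by rewrite P0 m0 gt_eqF.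
Qed.

(* [kcoef m] are the coefficients of the even polynomial [sum_i kcoef m i * t^(2 i)]
   reproducing the value at [0] in L^2(-1, 1): as [int_(-1)^1 t^(2 n) dt = (n + 1/2)^-1],
   this is a Cauchy system, solved by the factor [knodes] that cancels the poles
   [i = - j - 1/2] for [1 <= j <= m]. *)
Definition knodes (m : nat) : {poly R} :=
  \prod_(l < m) ('X + (l.+1%:R + 2^-1)%:P).

Definition knorm (m : nat) : R :=
  (\prod_(i < m.+1) (i%:R + 2^-1)) / (m`!%:R * m`!%:R).

Definition kcoef (m i : nat) : R :=
  knorm m * ((-1) ^+ i * 'C(m, i)%:R * (knodes m).[i%:R]).

Lemma size_knodes m : (size (knodes m) <= m.+1)%N.
Proof.
rewrite /knodes; elim: m => [|m IH]; first by rewrite big_ord0 size_poly1.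
rewrite big_ord_recr /=; apply: (leq_trans (size_polyMleq _ _)).
by rewrite size_XaddC addn2.
Qed.

Lemma kcoef_moment m j : (j <= m)%N ->
  \sum_(i < m.+1) kcoef m i / (i%:R + j%:R + 2^-1) = (j == 0%N)%:R.
Proof.
have pos (i k : nat) : i%:R + k%:R + 2^-1 != 0 :> R.
  by rewrite gt_eqF // ltr_wpDl // invr_gt0.
have E : \sum_(i < m.+1) kcoef m i / (i%:R + j%:R + 2^-1) =
   knorm m * altsum m (fun i => (knodes m).[i%:R] / (i%:R + j%:R + 2^-1)).
  by rewrite /altsum mulr_sumr; apply: eq_bigr => i _; rewrite /kcoef; ring.
rewrite {}E; case: j => [|j] jm.
  have /factor_theorem [Q EQ] : root (knodes m - ((knodes m).[- 2^-1])%:P) (- 2^-1).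
    by rewrite /root hornerD hornerN hornerC subrr.
  have EG : knodes m = ((knodes m).[- 2^-1])%:P + Q * ('X + (2^-1)%:P).
    by move: EQ; rewrite polyCN opprK => /eqP; rewrite subr_eq addrC => /eqP.
  have sQ : (size Q <= m)%N.
    have [->|Q0] := eqVneq Q 0; first by rewrite size_poly0.
    have : (size (Q * ('X + (2^-1)%:P))%R <= m.+1)%N.
      rewrite (_ : Q * _ = knodes m - ((knodes m).[- 2^-1])%:P); last first.
        by rewrite EQ polyCN opprK.
      apply: (leq_trans (size_polyD _ _)); rewrite geq_max size_knodes size_polyN size_polyC.
      by case: (_ != 0).
    by rewrite size_mul // -?size_poly_eq0 size_XaddC // addn2.
  rewrite (eq_altsum (v := fun i =>
    (knodes m).[- 2^-1] * (i%:R + 2^-1)^-1 + Q.[i%:R])); last first.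
    move=> i _; rewrite {1}EG hornerD hornerM hornerD hornerC hornerX hornerC.
    have := pos i 0%N; rewrite addr0 => i0.
    by rewrite mulrDl mulfK.
  rewrite altsumD altsumZ altsum_poly // addr0 altsum_inv ?invr_gt0 // eqxx.
  have -> : (knodes m).[- 2^-1] = m`!%:R.
    rewrite /knodes horner_prod fact_prod natr_prod big_add1 /= big_mkord.
    by apply: eq_bigr => i _; rewrite hornerD hornerX hornerC; ring.
  have f0 : m`!%:R != 0 :> R by rewrite pnatr_eq0 -lt0n fact_gt0.
  rewrite /knorm; set P := \prod_(_ < _) _.
  have P0 : P != 0.
    by apply/prodf_neq0 => i _; rewrite gt_eqF // ltr_wpDl // invr_gt0.
  by rewrite mulr1n; field; apply/andP.
pose jo := Ordinal jm.
rewrite (eq_altsum (v := fun i =>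
  (\prod_(l < m | l != jo) ('X + (l.+1%:R + 2^-1)%:P)).[i%:R])); last first.
  move=> i _; rewrite /knodes (bigD1 jo) //= hornerM hornerD hornerX hornerC.
  have := pos i j.+1; rewrite -addrA => ij.
  by rewrite mulrAC divff ?mul1r.
rewrite altsum_poly ?mulr0 //.
have : (size (knodes m) <= m.+1)%N := size_knodes m.
rewrite /knodes (bigD1 jo) //= size_mul ?size_XaddC //.
- by rewrite -size_poly_eq0 size_XaddC.
- by apply/prodf_neq0 => i _; rewrite -size_poly_eq0 size_XaddC.
Qed.

Lemma kcoef0_bounds m : 0 < kcoef m 0 <= (m.*2.+1)%:R / 2.
Proof.
have -> : kcoef m 0 = 2^-1 * \prod_(l < m) ((l.+1%:R + 2^-1) / l.+1%:R) ^+ 2.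
  rewrite /kcoef /knorm /knodes expr0 bin0 !mul1r horner_prod big_ord_recl /= add0r.
  rewrite fact_prod natr_prod big_add1 /= big_mkord prodrXl prodf_div.
  rewrite (eq_bigr (fun l : 'I_m => l.+1%:R + 2^-1)) //.
  rewrite [X in _ * X](eq_bigr (fun l : 'I_m => l.+1%:R + 2^-1)); last first.
    by move=> i _; rewrite hornerD hornerX hornerC add0r.
  have P0 : \prod_(i < m) (i.+1%:R : R) != 0 by apply/prodf_neq0 => i _; rewrite pnatr_eq0.
  by field.
apply/andP; split.
  by rewrite mulr_gt0 ?invr_gt0 // prodr_gt0.
rewrite [leRHS]mulrC ler_pM2l ?invr_gt0 //.
elim: m => [|m IH]; first by rewrite big_ord0.
rewrite big_ord_recr /=.
apply: (@le_trans _ _ ((m.*2.+1)%:R * ((m.+1%:R + 2^-1) / m.+1%:R) ^+ 2)).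
  by rewrite ler_pM2r // exprn_gt0 // divr_gt0 // ltr_wpDl // invr_gt0.
rewrite expr_div_n mulrA ler_pdivrMr ?exprn_gt0 // doubleS.
rewrite -!natr1 -!mul2n !natrM.
rewrite -subr_ge0 [leRHS](_ : _ = (2 * m%:R + 3) / 4); last by field.
by rewrite divr_ge0 // addr_ge0 // mulr_ge0.
Qed.

End altsum.

Section reproducing.
Variable R : realType.
Implicit Types (p q : {poly R}).

Definition primp p : {poly R} := \poly_(i < (size p).+1) (p`_i.-1 / i%:R).

Lemma coef_primp p i : (primp p)`_i = p`_i.-1 / i%:R.
Proof.
rewrite coef_poly; case: ltnP => // pi.
by rewrite nth_default ?mul0r //; case: i pi.
Qed.

Lemma deriv_primp p : (primp p)^`() = p.
Proof.
by apply/polyP => i; rewrite coef_deriv coef_primp /= -[LHS]mulr_natr divfK.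
Qed.

Lemma primp_is_linear : linear primp.
Proof.
move=> a p q; apply/polyP => i.
by rewrite coefD coefZ !coef_primp coefD coefZ mulrDl mulrA.
Qed.
HB.instance Definition _ :=
  GRing.isLinear.Build R {poly R} {poly R} _ primp primp_is_linear.

Lemma integral_poly p (a b : R) : a < b ->
  (\int[lebesgue_measure]_(x in `[a, b]) (p.[x])%:E =
   ((primp p).[b] - (primp p).[a])%:E)%E.
Proof.
move=> ab; rewrite EFinB; apply: continuous_FTC2 => //.
- by apply: continuous_subspaceT => x; exact: continuous_horner.
- split => [x _| |].
  + by case: (is_derive_poly (primp p) x).
  + by apply: cvg_at_right_filter; exact: continuous_horner.
  + by apply: cvg_at_left_filter; exact: continuous_horner.
- move=> x _; rewrite derive1E; case: (is_derive_poly (primp p) x) => _ ->.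
  by rewrite deriv_primp.
Qed.

Definition symint p : R := (primp p).[1] - (primp p).[-1].

Lemma symint_is_linear : linear_for *%R symint.
Proof.
move=> a p q; rewrite /symint linearP /= !hornerD !hornerZ; ring.
Qed.
HB.instance Definition _ :=
  GRing.isLinear.Build R {poly R} R *%R symint symint_is_linear.

Lemma symint_Xn n : symint 'X^n = (1 - (-1) ^+ n.+1) / n.+1%:R.
Proof.
have E : primp 'X^n = n.+1%:R^-1 *: 'X^(n.+1).
  apply/polyP => -[|i]; rewrite coef_primp coefZ !coefXn /=.
    by rewrite invr0 !mulr0.
  rewrite eqSS; have [->|_] := eqVneq i n; first by rewrite mulr1 mul1r.
  by rewrite mulr0 mul0r.
by rewrite /symint E !hornerZ !hornerXn expr1n; ring.
Qed.

Lemma symint_sqr_ge0 p : 0 <= symint (p ^+ 2).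
Proof.
rewrite -lee_fin -integral_poly ?gtrN //.
by apply: integral_ge0 => x _; rewrite lee_fin horner_exp sqr_ge0.
Qed.

Definition kernel (m : nat) : {poly R} := \sum_(i < m.+1) kcoef R m i *: 'X^(i.*2).

Lemma size_kernel m : (size (kernel m) <= m.*2.+1)%N.
Proof.
apply: (leq_trans (size_sum _ _ _)); apply/bigmax_leqP => i _.
apply: (leq_trans (size_scale_leq _ _)); rewrite size_polyXn ltnS leq_double.
by rewrite -ltnS.
Qed.

Lemma kernel_reproducing m q : (size q <= m.*2.+2)%N ->
  symint (q * kernel m) = q.[0].
Proof.
move=> sq.
have Eq : q = \sum_(j < m.*2.+2) q`_j *: 'X^j.
  rewrite -poly_def; apply/polyP => i; rewrite coef_poly; case: ltnP => // mi.
  by rewrite nth_default // (leq_trans sq).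
rewrite horner_coef0 {1}Eq mulr_suml linear_sum /=.
transitivity (\sum_(j < m.*2.+2) q`_j * (j == ord0)%:R); last first.
  rewrite big_ord_recl /= mulr1 big1 ?addr0 // => i _; by rewrite mulr0.
apply: eq_bigr => j _; rewrite -scalerAl linearZ /=; congr (_ * _).
rewrite /kernel mulr_sumr linear_sum /=.
transitivity (\sum_(i < m.+1) kcoef R m i * symint 'X^(j + i.*2)).
  by apply: eq_bigr => i _; rewrite -scalerAr linearZ /= exprD.
have jE := odd_double_half j; case jodd : (odd j) jE => /= jE.
  rewrite big1 => [|i _].
    rewrite -val_eqE /=; by case: (nat_of_ord j) jodd.
  rewrite symint_Xn -signr_odd /= oddD jodd odd_double /= expr0 subrr.
  by rewrite mul0r mulr0.
have jm : (j./2 <= m)%N.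
  by rewrite -ltnS -ltn_double; move: jE; rewrite add0n => ->; exact: ltn_ord.
rewrite -val_eqE /= -{2}jE double_eq0 -(kcoef_moment R jm).
apply: eq_bigr => i _; congr (_ * _).
rewrite symint_Xn -signr_odd /= oddD jodd odd_double /= expr1 opprK.
rewrite -{1}jE add0n -doubleD -natr1 -mul2n natrM natrD.
have ij : 0 < i%:R + j./2%:R + 2^-1 :> R by rewrite ltr_wpDl // invr_gt0.
field.
by rewrite ?(gt_eqF ij).
Qed.

(* Cauchy-Schwarz against the kernel [h], for which [int h^2 = h(0)]. *)
Lemma horner0_sqr_le d q : (size q <= d.+1)%N ->
  q.[0] ^+ 2 <= d.+1%:R / 2 * symint (q ^+ 2).
Proof.
move=> sq; pose m := d./2; pose h := kernel m.
have dm : (d.+1 <= m.*2.+2)%N.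
  by rewrite -{1}(odd_double_half d) ltnS; case: (odd d); rewrite ?add0n ?add1n ?ltnS ?leqnSn.
have /andP[k0 kle] := kcoef0_bounds R m.
have h0 : h.[0] = kcoef R m 0.
  rewrite /h /kernel horner_sum big_ord_recl /= hornerZ hornerXn expr0 mulr1.
  by rewrite big1 ?addr0 // => i _; rewrite hornerZ hornerXn expr0n /= mulr0.
have rq : symint (q * h) = q.[0] by apply: kernel_reproducing; exact: leq_trans dm.
have rh : symint (h * h) = h.[0].
  by apply: kernel_reproducing; apply: (leq_trans (size_kernel m)).
have h0' : 0 < h.[0] by rewrite h0.
have [l El] : exists l, q.[0] = l * h.[0].
  by exists (q.[0] / h.[0]); rewrite divfK // gt_eqF.
have := symint_sqr_ge0 (q - l *: h).
have -> : (q - l *: h) ^+ 2 = q ^+ 2 + ((- (l + l)) *: (q * h) + (l * l) *: (h * h)).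
  by rewrite -!mul_polyC polyCN polyCD polyCM; ring.
rewrite !linearD !linearZ /= rq rh => H.
have : q.[0] ^+ 2 <= h.[0] * symint (q ^+ 2).
  rewrite -subr_ge0; have := mulr_ge0 (ltW h0') H; rewrite El.
  by congr (0 <= _); ring.
move/le_trans; apply; apply: ler_wpM2r; first exact: symint_sqr_ge0.
rewrite h0; apply: (le_trans kle); rewrite ler_pM2r ?invr_gt0 // ler_nat ltnS.
by rewrite -[leqRHS](odd_double_half d) leq_addl.
Qed.

Lemma deriv_eq_horner_sub p q (a b : R) : p^`() = q^`() -> p.[a] - p.[b] = q.[a] - q.[b].
Proof.
move=> pq; have E : p - q = ((p - q)`_0)%:P.
  apply/polyP => -[|i]; rewrite coefC //=.
  have /polyP/(_ i) : (p - q)^`() = 0 by rewrite derivB pq subrr.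
  by rewrite coef_deriv coef0 => /eqP; rewrite mulrn_eq0 /= => /eqP.
have Ep : p = q + ((p - q)`_0)%:P by rewrite -E addrC subrK.
by rewrite Ep !hornerD !hornerC; ring.
Qed.

Lemma horner_sqr_le_integral d q (z e : R) : 0 < e -> (size q <= d.+1)%N ->
  ((q.[z] ^+ 2)%:E <= (d.+1%:R / (2 * e))%:E *
    \int[lebesgue_measure]_(t in `[(z - e)%R, (z + e)%R]) (q.[t] ^+ 2)%:E)%E.
Proof.
move=> e0 sq; pose s : {poly R} := e *: 'X + z%:P.
have ss : size s = 2%N.
  by rewrite size_polyDl size_scale ?gt_eqF // size_polyX // size_polyC; case: (_ != 0).
have := @horner0_sqr_le d (q \Po s); rewrite size_comp_poly2 // => /(_ sq).
rewrite horner_comp hornerD hornerZ hornerX hornerC mulr0 add0r => H.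
under eq_integral do rewrite -horner_exp.
rewrite integral_poly; last by rewrite ltrD2l gtrN.
rewrite -EFinM lee_fin; apply: (le_trans H).
rewrite [leRHS](_ : _ = d.+1%:R / 2 *
  (((primp (q ^+ 2)).[z + e] - (primp (q ^+ 2)).[z - e]) / e)); last first.
  field; by rewrite gt_eqF.
rewrite le_eqVlt; apply/orP; left; apply/eqP; congr (_ * _).
apply/(canRL (mulfK _)); first by rewrite gt_eqF.
have -> : z + e = s.[1] by rewrite hornerD hornerZ hornerX hornerC mulr1 addrC.
have -> : z - e = s.[-1] by rewrite hornerD hornerZ hornerX hornerC mulrN1 addrC.
rewrite -!horner_comp mulrC /symint mulrBr -!hornerZ.
apply: deriv_eq_horner_sub; rewrite derivZ deriv_comp !deriv_primp.
rewrite /s derivD derivZ derivX derivC addr0 rmorphXn /=.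
by rewrite alg_polyC -mul_polyC mulrC.
Qed.

End reproducing.

Section separately_polynomial.
Variables (R : realType) (d : nat).

Local Notation T n := (ls_T (leb_space R n)).
Local Notation mu n := (ls_m (leb_space R n)).

Fixpoint seppoly (n : nat) : (T n -> R) -> Prop :=
  match n return (T n -> R) -> Prop with
  | 0 => fun _ => True
  | m.+1 => fun f => exists g : 'I_d.+1 -> T m -> R,
      (forall j, @seppoly m (g j)) /\
      forall y, f y = \sum_(j < d.+1) g j y.1 * y.2 ^+ j
  end.

Lemma seppoly0 n : @seppoly n (fun=> 0).
Proof.
elim: n => [//|n IH]; exists (fun _ _ => 0); split => // y.
by rewrite big1 // => j _; rewrite mul0r.
Qed.

Lemma seppolyD n f g : @seppoly n f -> @seppoly n g ->
  seppoly (fun y => f y + g y).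
Proof.
elim: n f g => [//|n IH] f g [a [sa fa]] [b [sb gb]].
exists (fun j y => a j y + b j y); split => [j|y]; first exact: (IH _ _ (sa j) (sb j)).
by rewrite fa gb -big_split /=; apply: eq_bigr => j _; rewrite mulrDl.
Qed.

Lemma seppolyZ n c f : @seppoly n f -> seppoly (fun y => c * f y).
Proof.
elim: n f => [//|n IH] f [a [sa fa]].
exists (fun j y => c * a j y); split => [j|y]; first exact: (IH _ (sa j)).
by rewrite fa mulr_sumr; apply: eq_bigr => j _; rewrite mulrA.
Qed.

Lemma seppoly_sum n (I : Type) (r : seq I) (P : pred I) (F : I -> T n -> R) :
  (forall i, P i -> seppoly (F i)) -> seppoly (fun y => \sum_(i <- r | P i) F i y).
Proof.
move=> sF; elim: r => [|i r IH].
  rewrite (_ : (fun _ => _) = fun=> 0); first exact: seppoly0.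
  by apply/funext => y; rewrite big_nil.
case Pi : (P i).
  rewrite (_ : (fun _ => _) = fun y => F i y + \sum_(i <- r | P i) F i y).
    by apply: seppolyD => //; exact: sF.
  by apply/funext => y; rewrite big_cons Pi.
rewrite (_ : (fun _ => _) = fun y => \sum_(i <- r | P i) F i y) //.
by apply/funext => y; rewrite big_cons Pi.
Qed.

Lemma coord_max n (y : T n.+1) : Defs.coord y ord0 ord_max = y.2.
Proof. by rewrite mxE unlift_none. Qed.

Lemma lift_max_widen n (i : 'I_n) : lift ord_max i = widen_ord (leqnSn n) i.
Proof. by apply/val_inj; rewrite /= /bump leqNgt ltn_ord. Qed.

Lemma coord_widen n (y : T n.+1) (i : 'I_n) :
  Defs.coord y ord0 (widen_ord (leqnSn n) i) = Defs.coord y.1 ord0 i.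
Proof.
by rewrite mxE -lift_max_widen liftK.
Qed.

Lemma seppoly_monomial n (a : 'I_n -> 'I_d.+1) :
  @seppoly n (fun y => \prod_(i < n) Defs.coord y ord0 i ^+ a i).
Proof.
elim: n a => [//|n IH] a.
exists (fun j y => (j == a ord_max)%:R *
  \prod_(i < n) Defs.coord y ord0 i ^+ a (widen_ord (leqnSn n) i)); split.
  by move=> j; apply/seppolyZ/IH.
move=> y; rewrite [RHS](bigD1 (a ord_max)) // [RHS]/= eqxx mul1r [X in _ + X]big1 ?addr0.
  rewrite big_ord_recr coord_max; congr (_ * _).
  by apply: eq_bigr => i _; rewrite coord_widen.
by move=> j /negbTE ->; rewrite !mul0r.
Qed.

Lemma seppoly_peval n (c : {ffun exps n d -> R}) :
  @seppoly n (fun y => peval c (Defs.coord y)).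
Proof.
by apply: seppoly_sum => a _; apply/seppolyZ/seppoly_monomial.
Qed.

Lemma measurable_seppoly n f : @seppoly n f -> measurable_fun setT f.
Proof.
elim: n f => [|n IH] f; first by [].
move=> [g [sg fg]].
rewrite (_ : f = fun y => \sum_(j < d.+1) g j y.1 * y.2 ^+ j); last exact/funext.
apply: measurable_sum => j; apply: measurable_funM.
  exact: (measurableT_comp (IH _ (sg j)) measurable_fst).
by apply: measurable_funX; exact: measurable_snd.
Qed.

Lemma seppoly_slice n (f : T n.+1 -> R) (t : R) : seppoly f ->
  @seppoly n (fun y => f (y, t)).
Proof.
move=> [g [sg fg]].
rewrite (_ : (fun _ => _) = fun y => \sum_(j < d.+1) t ^+ j * g j y).
  by apply: seppoly_sum => j _; exact: (seppolyZ _ (sg j)).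
by apply/funext => y; rewrite fg; apply: eq_bigr => j _; rewrite mulrC.
Qed.

Lemma seppoly_poly n (f : T n.+1 -> R) (y : T n) : seppoly f ->
  exists2 q : {poly R}, (size q <= d.+1)%N & forall t, f (y, t) = q.[t].
Proof.
move=> [g [sg fg]]; exists (\poly_(j < d.+1) (if insub j is Some i then g i y else 0)).
  exact: size_poly.
move=> t; rewrite fg horner_poly; apply: eq_bigr => j _.
by rewrite valK.
Qed.

Fixpoint box (e : R) (n : nat) : T n -> set (T n) :=
  match n return T n -> set (T n) with
  | 0 => fun _ => setT
  | m.+1 => fun y => @box e m y.1 `*` `[y.2 - e, y.2 + e]%classic
  end.

Lemma measurable_box e n y : measurable (@box e n y).
Proof.
by elim: n y => [|n IH] y //; apply: measurableX; [exact: IH|exact: measurable_itv].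
Qed.

Lemma integral_setX n (A : set (T n)) (B : set R) (f : T n.+1 -> \bar R) :
  measurable A -> measurable (B : set (measurableTypeR R)) -> measurable_fun setT f ->
  (forall y, (0 <= f y)%E) ->
  (\int[mu n.+1]_(y in A `*` B) f y =
   \int[mu n]_(x in A) \int[lebesgue_measure]_(t in B) f (x, t))%E /\
  measurable_fun A (fun x => \int[lebesgue_measure]_(t in B) f (x, t))%E.
Proof.
move=> mA mB mf f0; set g := f \_ (A `*` B).
have mg : measurable_fun setT g.
  apply/(measurable_restrictT _ (measurableX mA mB)).
  exact: measurable_funS mf.
have g0 y : (0 <= g y)%E by rewrite /g patchE; case: ifP.
have E x : fubini_F lebesgue_measure g x =
    ((fun x => \int[lebesgue_measure]_(t in B) f (x, t))%E \_ A) x.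
  rewrite /fubini_F patchE; case: ifPn => xA.
    rewrite [RHS]integral_mkcond; apply: eq_integral => t _.
    by rewrite /g !patchE in_setX xA.
  by apply: integral0_eq => t _; rewrite /g patchE in_setX (negbTE xA).
split.
  rewrite integral_mkcond [RHS]integral_mkcond.
  rewrite [LHS](@fubini_tonelli1 _ _ _ _ _ (mu n) (@lebesgue_measure R) g) //.
  by apply: eq_integral => x _; rewrite E.
apply/(measurable_restrictT _ mA).
have := @measurable_fun_fubini_tonelli_F _ _ _ _ _ (@lebesgue_measure R) g mg g0.
by apply: eq_measurable_fun => x _; rewrite -E.
Qed.

Lemma seppoly_sqr_le_integral e n f y : 0 < e -> @seppoly n f ->
  ((f y ^+ 2)%:E <= ((d.+1%:R / (2 * e)) ^+ n)%:E *
    \int[mu n]_(x in box e y) (f x ^+ 2)%:E)%E.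
Proof.
move=> e0; elim: n f y => [|n IH] f y sf.
  by rewrite expr0 mul1e integral_dirac //= diracT mul1e; case: y.
have mf : measurable_fun setT (fun x => (f x ^+ 2)%:E).
  by apply/measurable_EFinP/measurable_funX/measurable_seppoly.
have [] := @integral_setX n (box e y.1) `[y.2 - e, y.2 + e]%classic (fun x => (f x ^+ 2)%:E).
- exact: measurable_box.
- exact: measurable_itv.
- exact: mf.
- by move=> x; rewrite lee_fin sqr_ge0.
move=> -> mF.
have K0 : 0 <= d.+1%:R / (2 * e) by rewrite divr_ge0 // mulr_ge0 // ltW.
have := IH (fun x => f (x, y.2)) y.1 (seppoly_slice y.2 sf).
rewrite -surjective_pairing => /le_trans; apply.
rewrite exprSr EFinM -muleA; apply: lee_wpmul2l; first by rewrite lee_fin exprn_ge0.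
rewrite -ge0_integralZl //; last 2 first.
- exact: measurable_box.
- by move=> x _; apply: integral_ge0 => t _; rewrite lee_fin sqr_ge0.
apply: ge0_le_integral => //.
- exact: measurable_box.
- by move=> x _; rewrite lee_fin sqr_ge0.
- apply: (@measurable_funS _ _ _ _ setT) => //.
  by apply/measurable_EFinP/measurable_funX/measurable_seppoly/seppoly_slice.
- exact: measurable_funeM.
- move=> x _; have [q sq fq] := seppoly_poly x sf.
  rewrite fq; under eq_integral do rewrite fq.
  exact: horner_sqr_le_integral.
Qed.

End separately_polynomial.

Section coordinates.
Variable R : realType.
Local Notation T n := (ls_T (leb_space R n)).
Local Notation mu n := (ls_m (leb_space R n)).

Lemma coord_surj n (x : 'rV[R]_n) : exists y : T n, Defs.coord y = x.
Proof.
elim: n x => [|n IH] x; first by exists tt; apply/rowP => -[].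
have [y yE] := IH (\row_i x ord0 (widen_ord (leqnSn n) i)).
exists (y, x ord0 ord_max); apply/rowP => i.
case: (unliftP ord_max i) => [j|] ->; last by rewrite coord_max.
by rewrite lift_max_widen coord_widen yE mxE.
Qed.

Lemma box_coord_le e n (y x : T n) i : box e y x ->
  `|Defs.coord y ord0 i - Defs.coord x ord0 i| <= e.
Proof.
elim: n y x i => [|n IH] y x i; first by case: i.
move=> [yx1 yx2]; case: (unliftP ord_max i) => [j|] ->; last first.
  rewrite !coord_max distrC ler_distl; move: yx2; rewrite /= in_itv /=.
  by rewrite lerBlDr.
by rewrite lift_max_widen !coord_widen; exact: IH.
Qed.

Lemma measurable_coord n i :
  measurable_fun setT (fun y : T n => Defs.coord y ord0 i : measurableTypeR R).
Proof.
elim: n i => [|n IH] i; first by case: i.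
case: (unliftP ord_max i) => [j|] ->.
  rewrite lift_max_widen; under eq_fun do rewrite coord_widen.
  exact: (measurableT_comp (IH j) measurable_fst).
under eq_fun do rewrite coord_max.
exact: measurable_snd.
Qed.

Lemma measurable_coord_ball n (x : 'rV[R]_n) e :
  measurable (@Defs.coord R n @^-1` ball x e).
Proof.
have [e0|e0] := ltP 0 e; last first.
  rewrite (_ : _ @^-1` _ = set0) //; apply/seteqP; split => // y [].
  by rewrite ltNge e0.
rewrite (_ : _ @^-1` _ = \bigcap_(i : 'I_n)
    ((fun y : T n => Defs.coord y ord0 i : measurableTypeR R) @^-1` ball (x ord0 i) e)).
  apply: fin_bigcap_measurable => [|i _]; first exact: finite_finset.
  rewrite -[X in measurable X]setTI.
  by apply: measurable_coord => //; exact: measurable_ball.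
apply/seteqP; split => y.
  by move=> [_ H] i _; exact: H.
by move=> H; split => // i j; rewrite (ord1 i); exact: H.
Qed.

Lemma measurable_coord_open n (U : set 'rV[R]_n) : open U ->
  measurable (@Defs.coord R n @^-1` U).
Proof.
move=> oU.
pose r (q : 'rV[rat]_n) : 'rV[R]_n := map_mx ratr q.
pose F (qk : 'rV[rat]_n * nat) : set (T n) :=
  if `[< ball (r qk.1) qk.2.+1%:R^-1 `<=` U >]
  then @Defs.coord R n @^-1` ball (r qk.1) qk.2.+1%:R^-1 else set0.
rewrite (_ : _ @^-1` U = \bigcup_qk F qk).
  apply: countable_bigcupT_measurable => [|qk]; first exact: countableP.
  by rewrite /F; case: ifP => // _; exact: measurable_coord_ball.
apply/seteqP; split => y /=; last first.
  by case=> qk _; rewrite /F; case: ifPn => // /asboolP; apply.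
set x := Defs.coord y => Ux.
have /nbhs_ballP [e /= e0 eU] : nbhs x U by apply: open_nbhs_nbhs.
have e20 : 0 < e / 2 by rewrite divr_gt0.
have [k _ /(_ k (leqnn k)) /= ke] := near_infty_natSinv_lt (PosNum e20).
have k0 : 0 < k.+1%:R^-1 :> R by rewrite invr_gt0.
have H i : exists q : rat, `|x ord0 i - ratr q| < k.+1%:R^-1.
  have /rat_in_itvoo[q] : x ord0 i < x ord0 i + k.+1%:R^-1 by rewrite ltrDl.
  rewrite in_itv /= => /andP[q1 q2]; exists q.
  by rewrite distrC gtr0_norm ?subr_gt0 // ltrBlDl.
have [q Hq] := choice H.
have xq : ball (r (\row_i q i)) k.+1%:R^-1 x.
  split=> // i j; rewrite (ord1 i) !mxE /ball /= distrC; exact: Hq.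
exists (\row_i q i, k) => //; rewrite /F; case: asboolP => //= -[] z qz.
apply: eU; apply: (@le_ball _ _ _ (k.+1%:R^-1 + k.+1%:R^-1)).
  by rewrite [leRHS]splitr lerD // ltW.
by apply: ball_triangle qz; exact: ball_sym.
Qed.

Lemma measurable_coord_closed n (S : set 'rV[R]_n) : closed S ->
  measurable (@Defs.coord R n @^-1` S).
Proof.
move=> cS; rewrite -[X in measurable X]setCK preimage_setC; apply: measurableC.
exact: (measurable_coord_open (closed_openC cS)).
Qed.

Lemma measurable_peval_sqr n d (c : {ffun exps n d -> R}) (D : set (T n)) :
  measurable_fun D (fun y => (peval c (Defs.coord y) ^+ 2)%:E).
Proof.
apply: (@measurable_funS _ _ _ _ setT) => //.
exact/measurable_EFinP/measurable_funX/measurable_seppoly/seppoly_peval.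
Qed.

Lemma peval_sqr_le_integral n d (c : {ffun exps n d -> R}) (S : set 'rV[R]_n) z e :
  0 < e -> closed S -> ball z e `<=` S ->
  ((peval c z ^+ 2)%:E <= ((d.+1%:R / e) ^+ n)%:E *
   \int[mu n]_(y in @Defs.coord R n @^-1` S) (peval c (Defs.coord y) ^+ 2)%:E)%E.
Proof.
move=> e0 cS zS; have [y yz] := coord_surj z.
have e20 : 0 < e / 2 by rewrite divr_gt0.
have := seppoly_sqr_le_integral y e20 (seppoly_peval c).
rewrite yz (_ : 2 * (e / 2) = e); last by field.
move/le_trans; apply; apply: lee_wpmul2l.
  by rewrite lee_fin exprn_ge0 // divr_ge0 // ltW.
apply: ge0_subset_integral.
- exact: measurable_box.
- exact: measurable_coord_closed.
- exact: measurable_peval_sqr.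
- by move=> x _; rewrite lee_fin sqr_ge0.
move=> x yx; apply: zS; split => // i j; rewrite (ord1 i) -yz /ball /=.
by apply: (le_lt_trans (box_coord_le j yx)); lra.
Qed.

Lemma unif_int_sqr_le n d (c : {ffun exps n d -> R}) (S : set 'rV[R]_n) (B : R) :
  closed S -> 0 < fine (leb S) -> (forall x, S x -> peval c x ^+ 2 <= B) ->
  (unif_int S (fun x => (peval c x ^+ 2)%R) <= B%:E)%E.
Proof.
move=> cS S0 cB; have mS := measurable_coord_closed cS.
rewrite /unif_int lee_pdivrMr //.
have -> : (fine (leb S))%:E = leb S.
  by rewrite fineK //; move: S0; case: (leb S) => //=; rewrite ltxx.
rewrite -integral_cst //; apply: ge0_le_integral => //.
- by move=> x _; rewrite lee_fin sqr_ge0.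
- exact: measurable_peval_sqr.
- by move=> x Sx; rewrite lee_fin cB.
Qed.

End coordinates.

Section polynomial_functions.
Variables (R : realType) (n : nat).
Implicit Types (f g : 'rV[R]_n -> R).

Definition polyfun (d : nat) f :=
  exists c : {ffun exps n d -> R}, forall x, peval c x = f x.

Lemma polyfun0 d : polyfun d (fun=> 0).
Proof.
by exists [ffun=> 0] => x; rewrite /peval big1 // => a _; rewrite ffunE mul0r.
Qed.

Lemma polyfunD d f g : polyfun d f -> polyfun d g -> polyfun d (fun x => f x + g x).
Proof.
move=> [a fa] [b gb]; exists [ffun i => a i + b i] => x.
by rewrite -fa -gb /peval -big_split; apply: eq_bigr => i _; rewrite ffunE mulrDl.
Qed.

Lemma polyfunZ d k f : polyfun d f -> polyfun d (fun x => k * f x).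
Proof.
move=> [a fa]; exists [ffun i => k * a i] => x.
by rewrite -fa /peval mulr_sumr; apply: eq_bigr => i _; rewrite ffunE mulrA.
Qed.

Lemma polyfun_sum d (I : Type) (r : seq I) (P : pred I) (F : I -> 'rV[R]_n -> R) :
  (forall i, P i -> polyfun d (F i)) -> polyfun d (fun x => \sum_(i <- r | P i) F i x).
Proof.
move=> sF; elim: r => [|i r IH].
  by have [c cE] := polyfun0 d; exists c => x; rewrite cE big_nil.
case Pi : (P i).
  have [c cE] := polyfunD (sF _ Pi) IH.
  by exists c => x; rewrite cE big_cons Pi.
by have [c cE] := IH; exists c => x; rewrite cE big_cons Pi.
Qed.

Lemma polyfun_monomial d (a : 'I_n -> nat) : (\sum_(i < n) a i <= d)%N ->
  polyfun d (fun x => \prod_(i < n) x ord0 i ^+ a i).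
Proof.
move=> ad; pose A : exps n d := [ffun i => inord (a i)].
have Aa i : (A i : nat) = a i.
  rewrite ffunE inordK // ltnS; apply: leq_trans ad.
  by rewrite (bigD1 i) //= leq_addr.
exists [ffun b => (b == A)%:R] => x.
rewrite /peval (bigD1 A) /=; last first.
  by under eq_bigr do rewrite Aa.
rewrite ffunE eqxx mul1r [X in _ + X]big1 ?addr0; last first.
  by move=> b /andP[_ /negbTE bA]; rewrite ffunE bA mul0r.
by apply: eq_bigr => i _; rewrite Aa.
Qed.

Lemma polyfunM d1 d2 f g : polyfun d1 f -> polyfun d2 g ->
  polyfun (d1 + d2) (fun x => f x * g x).
Proof.
move=> [a fa] [b gb].
have [c cE] : polyfun (d1 + d2) (fun x =>
    \sum_(i : exps n d1 | (\sum_(l < n) (i l : nat) <= d1)%N)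
    \sum_(j : exps n d2 | (\sum_(l < n) (j l : nat) <= d2)%N)
      a i * (b j * \prod_(l < n) x ord0 l ^+ (i l + j l)%N)).
  apply: polyfun_sum => i i1; apply: polyfun_sum => j j2.
  apply/polyfunZ/polyfunZ/polyfun_monomial.
  by rewrite big_split /= leq_add.
exists c => x; rewrite cE -fa -gb /peval mulr_suml; apply: eq_bigr => i _.
rewrite mulr_sumr; apply: eq_bigr => j _.
under eq_bigr do rewrite exprD.
by rewrite big_split /=; ring.
Qed.

Lemma polyfun_cst d k : polyfun d (fun=> k).
Proof.
have [|c cE] := @polyfun_monomial d (fun=> 0%N); first by rewrite big1.
have [c' cE'] : polyfun d (fun x => k * peval c x) by apply: polyfunZ; exists c.
by exists c' => x; rewrite cE' cE big1 ?mulr1 // => i _; rewrite expr0.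
Qed.

Lemma polyfun_coord i : polyfun 1 (fun x => x ord0 i).
Proof.
have [|c cE] := @polyfun_monomial 1 (fun j => (j == i : nat)).
  by rewrite (bigD1 i) //= eqxx big1 // => j /negbTE ->.
exists c => x; rewrite cE (bigD1 i) //= eqxx expr1 big1 ?mulr1 //.
by move=> j /negbTE ->; rewrite expr0.
Qed.

Lemma polyfun_leq d1 d2 f : (d1 <= d2)%N -> polyfun d1 f -> polyfun d2 f.
Proof.
move=> d12 fd; have [c cE] := polyfunM fd (polyfun_cst (d2 - d1) 1).
by move: c cE; rewrite subnKC // => c cE; exists c => x; rewrite cE mulr1.
Qed.

Lemma polyfunX d k f : polyfun d f -> polyfun (k * d) (fun x => f x ^+ k).
Proof.
move=> fd; elim: k => [|k IH]; first exact: polyfun_cst.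
have [c cE] := polyfunM fd IH.
by exists c => x; rewrite cE exprS.
Qed.

End polynomial_functions.

Section hausdorff_convergence.
Variables (R : realType) (n : nat).
Implicit Types (A S X Y : set 'rV[R]_n) (x y z : 'rV[R]_n).

Lemma ball_segment x (e : R) a b (t : R) : 0 <= t <= 1 ->
  ball x e a -> ball x e b -> ball x e (a + t *: (b - a)).
Proof.
move=> /andP[t0 t1] [e0 xa] [_ xb]; split => // i j.
move: (xa i j) (xb i j); rewrite /ball /= !mxE => xa' xb'.
rewrite (_ : _ - _ = (1 - t) * (x i j - a i j) + t * (x i j - b i j)); last by ring.
apply: (le_lt_trans (ler_normD _ _)); rewrite !normrM.
rewrite (ger0_norm t0) (@ger0_norm _ (1 - t)) ?subr_ge0 //.
have [->|tn0] := eqVneq t 0; first by rewrite subr0 mul1r mul0r addr0.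
have tp : 0 < t by rewrite lt0r tn0.
rewrite [ltRHS](_ : e = (1 - t) * e + t * e); last by ring.
apply: ler_ltD; last by rewrite ltr_pM2l.
by rewrite ler_wpM2l ?subr_ge0 // ltW.
Qed.

Lemma bdry_meets_ball A x (e : R) a b : ball x e a -> ball x e b -> A a -> ~ A b ->
  exists2 w, ball x e w & bdry A w.
Proof.
move=> xa xb Aa nAb; apply: contrapT => nw.
pose g (t : R) : 'rV[R]_n := a + t *: (b - a).
have cg : continuous g.
  move=> t; apply: cvgD; first exact: cvg_cst.
  by apply: cvgZl; exact: cvg_id.
have gi t : `[0, 1]%classic t -> closure A (g t) -> interior A (g t).
  rewrite /= in_itv /= => t01 clA; apply: contrapT => nint.
  by apply: nw; exists (g t); [exact: ball_segment|split].
have g0 : g 0 = a by rewrite /g scale0r addr0.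
have g1 : g 1 = b by rewrite /g scale1r addrC subrK.
pose B : set R := `[0, 1]%classic `&` g @^-1` interior A.
have : B = `[0, 1]%classic.
  apply: segment_connected.
  - exists 0; split; first by rewrite /= in_itv /= lexx ler01.
    rewrite /= g0 -g0; apply: gi; first by rewrite /= in_itv /= lexx ler01.
    by rewrite g0; exact: subset_closure.
  - exists (g @^-1` interior A) => //.
    by apply: open_comp => [t _|]; [exact: cg|exact: open_interior].
  - exists (g @^-1` closure A).
      by apply: preimage_closed => //; exact: closed_closure.
    apply/seteqP; split => t [t01 gt]; split => //; last exact: gi.
    exact: (subset_closure (interior_subset gt)).
move/seteqP => [_ /(_ 1)]; rewrite /= in_itv /= lexx ler01 => /(_ isT) [_].
by rewrite /= g1 => /interior_subset.
Qed.

Lemma compact_uniform_ball (K U : set 'rV[R]_n) (e : R) : compact K -> 0 < e ->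
  (forall x, K x -> closure (interior U) x) ->
  exists2 r, 0 < r & forall x, K x -> exists2 y, ball x e y & ball y r `<=` U.
Proof.
move=> cK e0 KU.
pose P (r : R) x := exists2 y, ball x e y & ball y r `<=` U.
have e20 : 0 < e / 2 by rewrite divr_gt0.
have : \forall r \near (0 : R)^'+, K `<=` P r.
  apply: (proj1 (compact_near_coveringP K) cK) => x Kx.
  have [y [Uy xy]] := KU x Kx _ (nbhsx_ballx x _ e20).
  have /nbhs_ballP[r0 /= r00 yU] := Uy.
  exists (ball x (e / 2), [set r | r < r0]).
    by split; [exact: nbhsx_ballx|exact: nbhs_right_lt].
  move=> [x' r] [/= xx' rr0]; exists y.
    rewrite [e]splitr; apply: ball_triangle xy; exact: ball_sym.
  by move=> z yz; apply: yU; apply: le_ball yz; exact: ltW.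
move=> H; have [r [r0 Kr]] := filter_ex (filterI (nbhs_right_gt (0 : R)) H).
by exists r.
Qed.

Lemma compact_sub_ball S : compact S -> exists2 M : R, 0 < M & S `<=` ball (0 : 'rV[R]_n) M.
Proof.
move=> /compact_bounded [M [_ /(_ (`|M| + 1))]] SM.
exists (`|M| + 2); first by rewrite ltr_wpDl.
move=> x Sx; rewrite mx_norm_ball /ball_ /= sub0r normrN.
apply: (@le_lt_trans _ _ (`|M| + 1)); last by rewrite ltrD2l ltr1n.
by apply: SM => //; rewrite ltr_pwDr // ler_norm.
Qed.

Lemma eucl_ge0 x : 0 <= eucl x. Proof. exact: sqrtr_ge0. Qed.

Lemma eucl_le_ball x y (e : R) : ball x e y -> eucl (x - y) <= n%:R * e.
Proof.
move=> [e0 xy]; have ne0 : 0 <= n%:R * e by rewrite mulr_ge0 // ltW.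
rewrite -(ger0_norm ne0) -sqrtr_sqr ler_wsqrtr //.
apply: (@le_trans _ _ (\sum_(i < n) e ^+ 2)).
  apply: ler_sum => i _; rewrite !mxE -real_normK ?num_real // lerXn2r ?nnegrE ?(ltW e0) //.
  exact/ltW/xy.
rewrite sumr_const card_ord -[leLHS]mulr_natl exprMn ler_pM2r ?exprn_gt0 //.
by rewrite -natrX ler_nat; case: (n) => // m; rewrite -mulnn leq_pmulr.
Qed.

Lemma hausdorff_bounds X Y (e : R) : Y !=set0 ->
  (forall x, X x -> exists2 y, Y y & eucl (x - y) <= e) ->
  (forall y, Y y -> exists2 x, X x & eucl (x - y) <= e) ->
  (0 <= hausdorff X Y <= e%:E)%E.
Proof.
move=> [y0 Yy0] XY YX; have [x0 Xx0 _] := YX _ Yy0.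
apply/andP; split; rewrite /hausdorff.
  rewrite le_max; apply/orP; left.
  apply: (@le_trans _ _ (ereal_inf [set (eucl (x0 - y))%:E | y in Y])).
    by apply: le_ereal_inf_tmp => _ [y _ <-]; rewrite lee_fin eucl_ge0.
  by apply: ereal_sup_ubound; exists x0.
rewrite ge_max; apply/andP; split; apply: ge_ereal_sup => _ [u Hu <-].
  have [y Yy ye] := XY _ Hu; apply: ge_ereal_inf.
  exists (eucl (u - y))%:E; last by rewrite lee_fin.
  by exists y.
have [x Xx xe] := YX _ Hu; apply: ge_ereal_inf.
exists (eucl (x - u))%:E; last by rewrite lee_fin.
by exists x.
Qed.

Lemma cvg_hausdorff0 (X : nat -> set 'rV[R]_n) Y : Y !=set0 ->
  (forall e : R, 0 < e -> \forall k \near \oo,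
    (forall x, X k x -> exists2 y, Y y & ball x e y) /\
    (forall y, Y y -> exists2 x, X k x & ball y e x)) ->
  hausdorff (X k) Y @[k --> \oo] --> 0%:E.
Proof.
move=> Y0 XY.
have H (e : R) : 0 < e -> \forall k \near \oo, (0 <= hausdorff (X k) Y <= e%:E)%E.
  move=> e0; have e'0 : 0 < e / n.+1%:R by rewrite divr_gt0.
  have ne x y : ball x (e / n.+1%:R) y -> eucl (x - y) <= e.
    move=> xy; apply: (le_trans (eucl_le_ball xy)).
    rewrite mulrCA; apply: ler_piMr; first exact: ltW.
    by rewrite ler_pdivrMr // mul1r ler_nat.
  apply: filterS (XY _ e'0) => k [XkY YXk]; apply: hausdorff_bounds => //.
    by move=> x /XkY [y Yy xy]; exists y => //; exact: ne.
  by move=> y /YXk [x Xx xy]; exists x => //; apply/ne/ball_sym.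
have fin (e : R) k : (0 <= hausdorff (X k) Y <= e%:E)%E -> hausdorff (X k) Y \is a fin_num.
  by move=> /andP[h0 he]; rewrite ge0_fin_numE // (le_lt_trans he) // ltry.
apply/fine_cvgP; split.
  by apply: filterS (H _ ltr01) => k; exact: fin.
apply/cvgrPdist_le => e e0; apply: filterS (H _ e0) => k hk.
have := hk; rewrite -(fineK (fin _ _ hk)) !lee_fin sub0r normrN => /andP[h0 he].
by rewrite ger0_norm.
Qed.

Lemma cvg_hausdorff_set_bdry S (Sk : nat -> set 'rV[R]_n) :
  (0 < n)%N -> compact S -> S !=set0 -> closure (interior S) = S ->
  (forall e : R, 0 < e -> \forall k \near \oo, forall y, ball y e `<=` S -> Sk k y) ->
  (forall e : R, 0 < e -> \forall k \near \oo, forall z, ball z e `<=` ~` S -> ~ Sk k z) ->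
  hausdorff (Sk k) S @[k --> \oo] --> 0%:E /\
  hausdorff (bdry (Sk k)) (bdry S) @[k --> \oo] --> 0%:E.
Proof.
move=> n0 cS S0 clS inS exS.
have closedS : closed S by rewrite -clS; exact: closed_closure.
have near_in (e : R) : 0 < e -> \forall k \near \oo,
    forall x, S x -> exists2 y, ball x e y & Sk k y.
  move=> e0; have [|r r0 Hr] := @compact_uniform_ball S S e cS e0.
    by rewrite clS.
  by apply: filterS (inS _ r0) => k Hk x /Hr[y xy yS]; exists y => //; exact: Hk.
have near_out (e : R) : 0 < e -> \forall k \near \oo,
    forall x, bdry S x -> exists2 y, ball x e y & ~ Sk k y.
  move=> e0; have cB : compact (bdry S).
    apply: subclosed_compact cS _; last by move=> x [+ _]; rewrite -((closure_id S).1 closedS).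
    by apply: closedI; [exact: closed_closure|exact/open_closedC/open_interior].
  have [|r r0 Hr] := @compact_uniform_ball (bdry S) (~` S) e cB e0.
    move=> x [_ nx]; rewrite ((interior_id _).1 (closed_openC closedS)).
    by apply: contrapT => ncl; apply: nx; rewrite -[S]setCK interiorC.
  by apply: filterS (exS _ r0) => k Hk x /Hr[y xy yS]; exists y => //; exact: Hk.
have far (e : R) k x : (forall z, ball z e `<=` ~` S -> ~ Sk k z) -> Sk k x ->
    exists2 y, S y & ball x e y.
  move=> Hk Skx; apply: contrapT => ny; apply: (Hk x) => // y xy Sy.
  by apply: ny; exists y.
have deep (e : R) k x : (forall y, ball y e `<=` S -> Sk k y) -> ~ Sk k x ->
    exists2 y, ~ S y & ball x e y.
  move=> Hk Skx; apply: contrapT => ny; apply/Skx/Hk => y xy; apply: contrapT => nSy.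
  by apply: ny; exists y.
have B0 : bdry S !=set0.
  have [a Sa] := S0; have [M M0 SM] := compact_sub_ball cS.
  pose b : 'rV[R]_n := const_mx M.
  have nSb : ~ S b.
    move=> /SM [_ /(_ ord0 (Ordinal n0))]; rewrite /ball /= !mxE sub0r normrN.
    by rewrite gtr0_norm // ltxx.
  have [||w _ ?] := @bdry_meets_ball S a (`|a - b| + 1) a b _ _ Sa nSb; last by exists w.
    by apply: ballxx; rewrite ltr_wpDl.
  by rewrite mx_norm_ball /ball_ /= ltrDl.
split; apply: cvg_hausdorff0 => // e e0.
  near=> k; split.
    have H : forall z, ball z e `<=` ~` S -> ~ Sk k z by near: k; exact: exS.
    by move=> x; exact: far.
  have H : forall x, S x -> exists2 y, ball x e y & Sk k y by near: k; exact: near_in.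
  by move=> y /H[x]; exists x.
have e20 : 0 < e / 2 by rewrite divr_gt0.
near=> k.
have Hin : forall y, ball y (e / 2) `<=` S -> Sk k y by near: k; exact: inS.
have Hex : forall z, ball z (e / 2) `<=` ~` S -> ~ Sk k z by near: k; exact: exS.
have Hni : forall x, S x -> exists2 y, ball x e y & Sk k y by near: k; exact: near_in.
have Hno : forall x, bdry S x -> exists2 y, ball x e y & ~ Sk k y by near: k; exact: near_out.
split=> x [xcl xint].
  have [y1 [Sky1 xy1]] := xcl _ (nbhsx_ballx x _ e20).
  have [y2 Sy2 y12] := far _ _ _ Hex Sky1.
  have [z1 nSkz1 xz1] : exists2 z, ~ Sk k z & ball x (e / 2) z.
    apply: contrapT => nz; apply: xint; apply/nbhs_ballP; exists (e / 2) => //= z xz.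
    by apply: contrapT => nSkz; apply: nz; exists z.
  have [z2 nSz2 z12] := deep _ _ _ Hin nSkz1.
  have xy2 : ball x e y2 by rewrite [e]splitr; exact: ball_triangle y12.
  have xz2 : ball x e z2 by rewrite [e]splitr; exact: ball_triangle z12.
  by have [w xw Bw] := bdry_meets_ball xy2 xz2 Sy2 nSz2; exists w.
have Sx : S x by rewrite ((closure_id S).1 closedS).
have [y1 xy1 Sky1] := Hni _ Sx.
have [z1 xz1 nSkz1] := Hno x (conj xcl xint).
by have [w xw Bw] := bdry_meets_ball xy1 xz1 Sky1 nSkz1; exists w.
Unshelve. all: by end_near. Qed.

End hausdorff_convergence.

Lemma binS_add p d : (p.+1 * 'C(p.+1 + d, d) = (p.+1 + d) * 'C(p + d, d))%N.
Proof.
have E q : 'C(q + d, d) = 'C(q + d, q).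
  by rewrite -[RHS]bin_sub ?leq_addr // addKn.
by rewrite !E addSn -mul_bin_diag.
Qed.

Lemma expn_leq_fact_bin p d : (d.+1 ^ p <= p`! * 'C(p + d, d))%N.
Proof.
elim: p => [|p IH]; first by rewrite expn0 fact0 mul1n bin_gt0 leq_addl.
rewrite factS expnS mulnAC binS_add -mulnA leq_mul //.
  by rewrite addSn ltnS leq_addl.
by rewrite mulnC.
Qed.

Lemma bin_leq_expn p d : ('C(p + d, d) <= d.+1 ^ p)%N.
Proof.
elim: p => [|p IH]; first by rewrite add0n binn expn0.
rewrite -(leq_pmul2l (ltn0Sn p)) binS_add expnS mulnA leq_mul //.
by rewrite mulnS leq_add2l leq_pmull.
Qed.

Section christoffel_bounds.
Variables (R : realType) (n : nat).
Implicit Types (S : set 'rV[R]_n) (x y z : 'rV[R]_n).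

Lemma christoffel_ge S d y (e : R) : closed S -> 0 < fine (leb S) -> 0 < e ->
  ball y e `<=` S ->
  (((e / d.+1%:R) ^+ n / fine (leb S))%:E <= christoffel (unif_int S) d y)%E.
Proof.
move=> cS S0 e0 yS; apply: le_ereal_inf_tmp => _ [c /= cy <-].
have := peval_sqr_le_integral c e0 cS yS; rewrite cy expr1n => H.
rewrite /unif_int lee_pdivlMr // -EFinM divfK ?gt_eqF //.
have K0 : 0 < (d.+1%:R / e) ^+ n by rewrite exprn_gt0 // divr_gt0.
by move: H; rewrite -lee_pdivrMl // mule1 -exprVn invf_div.
Qed.

Lemma coord_le_norm x i : `|x ord0 i| <= `|x|.
Proof.
rewrite [leRHS]mx_normrE.
exact: (le_bigmax _ (fun ij => `|x ij.1 ij.2|) (ord0, i)).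
Qed.

Lemma sqr_norm_le_sum x : `|x| ^+ 2 <= \sum_(i < n) x ord0 i ^+ 2.
Proof.
have [->|] := eqVneq `|x| 0; first by rewrite expr0n /= sumr_ge0 // => i _; rewrite sqr_ge0.
move=> /mx_norm_neq0 [[i j] /= E]; rewrite [`|x|]E (ord1 i) (bigD1 j) //=.
by rewrite real_normK ?num_real // lerDl sumr_ge0 // => k _; rewrite sqr_ge0.
Qed.

Lemma sum_sqr_le_norm x : \sum_(i < n) x ord0 i ^+ 2 <= n%:R * `|x| ^+ 2.
Proof.
apply: (@le_trans _ _ (\sum_(i < n) `|x| ^+ 2)); last first.
  by rewrite sumr_const card_ord mulr_natl.
apply: ler_sum => i _.
by rewrite -real_normK ?num_real // lerXn2r ?nnegrE // coord_le_norm.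
Qed.

(* The test polynomial is [(1 - |y - z|^2 / (n * U^2)) ^ (d / 2)] with [U]
   bounding the sup-distance from [z] to points of [S]. *)
Lemma christoffel_le S (e : R) : (0 < n)%N -> compact S -> closed S ->
  0 < fine (leb S) -> 0 < e ->
  exists2 t : R, 0 < t < 1 & forall d z, ball z e `<=` ~` S ->
    (christoffel (unif_int S) d z <= (t ^+ (d./2).*2)%:E)%E.
Proof.
move=> n0 cS clS S0 e0; have [M M0 SM] := compact_sub_ball cS.
have n0' : 0 < n%:R :> R by rewrite ltr0n.
have n1 : 1 <= n%:R :> R by rewrite ler1n.
pose s : R := (e / (e + 2 * M)) ^+ 2 / n%:R.
have eM : 0 < e + 2 * M by rewrite addr_gt0 // mulr_gt0.
have s0 : 0 < s by rewrite divr_gt0 // exprn_gt0 // divr_gt0.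
have s1 : s < 1.
  rewrite ltr_pdivrMr // mul1r (lt_le_trans _ n1) // expr_lt1 //.
    by rewrite ltr_pdivrMr // mul1r ltrDl mulr_gt0.
  by rewrite divr_ge0 // ltW.
exists (1 - s); first by rewrite subr_gt0 s1 gtrBl.
move=> d z zS; pose U := `|z| + M.
have U0 : 0 < U by rewrite ltr_wpDl.
pose Q y := 1 - (\sum_(i < n) (y ord0 i - z ord0 i) ^+ 2) / (n%:R * U ^+ 2).
have pQ : polyfun 2 Q.
  have [c cE] : polyfun 2 (fun y => 1 + (- (n%:R * U ^+ 2)^-1) *
      \sum_(i < n) ((y ord0 i + (- z ord0 i)) ^+ 2)).
    apply: polyfunD; first exact: polyfun_cst.
    apply: polyfunZ; apply: polyfun_sum => i _.
    apply: (@polyfunX _ _ 1 2 (fun y => y ord0 i + (- z ord0 i))).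
    by apply: polyfunD; [exact: polyfun_coord|exact: polyfun_cst].
  by exists c => y; rewrite cE /Q mulNr mulrC.
have [c cE] : polyfun d (fun y => Q y ^+ d./2).
  apply: (@polyfun_leq _ _ (d./2 * 2)%N); last exact: polyfunX.
  by rewrite muln2 -[leqRHS]odd_double_half leq_addl.
apply: (@le_trans _ _ (unif_int S (fun x => (peval c x ^+ 2)%R))).
  apply: ereal_inf_lbound; exists c => //=; rewrite cE /Q big1; last first.
    by move=> i _; rewrite subrr expr0n.
  by rewrite mul0r subr0 expr1n.
apply: unif_int_sqr_le => // y Sy; rewrite cE -exprM muln2.
have yM : `|y| < M.
  by have := SM _ Sy; rewrite mx_norm_ball /ball_ /= sub0r normrN.
have yz : e <= `|y - z|.
  rewrite leNgt; apply/negP => yz; apply: (zS y) => //.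
  by rewrite mx_norm_ball /ball_ /= distrC.
pose N := `|y - z|.
have NU : N <= U by rewrite /N /U (le_trans (ler_normB _ _)) // addrC lerD2l ltW.
have UN : U <= N + 2 * M.
  have : `|z| <= N + `|y|.
    by rewrite -{1}(subrK y z) (le_trans (ler_normD _ _)) // lerD2r distrC.
  rewrite /U; lra.
have N0 : 0 < N by exact: lt_le_trans yz.
have sumE : \sum_(i < n) (y ord0 i - z ord0 i) ^+ 2 = \sum_(i < n) (y - z) ord0 i ^+ 2.
  by apply: eq_bigr => i _; rewrite !mxE.
have nU : 0 < n%:R * U ^+ 2 by rewrite mulr_gt0 // exprn_gt0.
have Q0 : 0 <= Q y.
  rewrite /Q subr_ge0 ler_pdivrMr // mul1r sumE (le_trans (sum_sqr_le_norm _)) //.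
  by rewrite ler_pM2l // lerXn2r ?nnegrE // ltW.
have Q1 : Q y <= 1 - s.
  rewrite /Q lerD2l lerN2 ler_pdivlMr // sumE; apply: le_trans (sqr_norm_le_sum _).
  rewrite /s mulrA divfK ?gt_eqF // -exprMn lerXn2r ?nnegrE //.
    by rewrite mulr_ge0 ?divr_ge0 // ltW.
  rewrite mulrAC ler_pdivrMr // -/N.
  apply: (@le_trans _ _ (e * (N + 2 * M))); first by rewrite ler_pM2l.
  rewrite !mulrDr [e * N]mulrC lerD2l ler_pM2r // mulr_gt0 //.
by rewrite lerXn2r ?nnegrE // subr_ge0 ltW.
Qed.

Lemma diam_gt0 S : (0 < n)%N -> compact S -> interior S !=set0 -> 0 < Defs.diam S.
Proof.
move=> n0 cS [x xS]; have [M M0 SM] := compact_sub_ball cS.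
have /nbhs_ballP[r /= r0 rS] := xS.
pose y : 'rV[R]_n := x + const_mx (r / 2).
have Sy : S y.
  apply: rS; split => // i j; rewrite /ball /= !mxE opprD addrA subrr sub0r normrN.
  by rewrite gtr0_norm ?divr_gt0 // gtr_pMr // invf_lt1 // ltr1n.
apply: (@lt_le_trans _ _ (eucl (x - y))).
  rewrite sqrtr_gt0 (bigD1 (Ordinal n0)) //= ltr_pwDl //; last first.
    by rewrite sumr_ge0 // => i _; rewrite sqr_ge0.
  rewrite exprn_even_gt0 // !mxE opprD addrA subrr sub0r oppr_eq0 /=.
  by rewrite gt_eqF // divr_gt0.
apply: ub_le_sup; last by exists x; [exact: interior_subset|exists y].
exists (n%:R * (M + M)) => _ [u Su [v Sv <-]]; apply: eucl_le_ball.
by apply: ball_triangle (SM _ Sv); apply: ball_sym; exact: SM.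
Qed.

End christoffel_bounds.

Section thresholds.
Variables (R : realType) (p : nat) (S : set 'rV[R]_p).
Hypothesis p0 : (0 < p)%N.

Lemma dlhs_ge (delta : R) d : 0 < delta -> 0 < Defs.diam S -> (0 < d)%N ->
  expR (- (2 * (delta / (delta + Defs.diam S)) * d%:R)) * d%:R ^+ p * (expR 1 / p%:R) ^+ p
  <= dlhs S delta d.
Proof.
move=> de0 D0 d0; set k := delta / (delta + Defs.diam S).
have k0 : 0 <= k * d%:R by rewrite mulr_ge0 // divr_ge0 ?addr_ge0 // ltW.
have A0 : 0 <= d%:R ^+ p * (expR 1 / p%:R) ^+ p :> R.
  by rewrite mulr_ge0 ?exprn_ge0 // divr_ge0 ?expR_ge0.
have l0 : 0 < ln (2 : R) by rewrite ln_gt0 // ltr1n.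
have l2 : ln (2 : R) < 2 by rewrite ln_sublinear.
rewrite /dlhs.
have -> : delta * d%:R / (delta + Defs.diam S) = k * d%:R by rewrite /k mulrAC.
rewrite -[leLHS]mulr1; apply: ler_pM => //.
- rewrite -[leLHS]mulrA -[leRHS]mulrA; apply: ler_wpM2r; first exact: A0.
  rewrite /powR pnatr_eq0 /= ler_expR; nra.
- by rewrite -expR0 ler_expR divr_ge0 // exprn_ge0.
Qed.

Lemma dlhs_gt0 (delta : R) d : (0 < d)%N -> 0 < dlhs S delta d.
Proof.
move=> d0; rewrite /dlhs !mulr_gt0 ?expR_gt0 ?powR_gt0 ?exprn_gt0 ?ltr0n //.
by rewrite divr_gt0 ?expR_gt0 ?ltr0n.
Qed.

Lemma alpha_gt0_leb_omega (delta : R) d : 0 < delta -> 0 < alpha S delta d ->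
  0 < fine (leb S) /\ 0 < omega R p.
Proof.
move=> de0; rewrite /alpha pmulr_lgt0; last first.
  by rewrite divr_gt0 ?mulr_gt0 // ltr_wpDl ?addr_ge0 ?mulr_ge0.
rewrite -mulrA pmulr_rgt0 ?exprn_gt0 // => H.
have S0 : 0 <= fine (leb S) by exact/fine_ge0/measure_ge0.
have S1 : 0 < fine (leb S).
  rewrite lt0r S0 andbT; apply/eqP => E.
  by move: H; rewrite E invr0 mulr0 ltxx.
by split => //; move: H; rewrite pmulr_lgt0 // invr_gt0.
Qed.

Lemma alpha_le (delta : R) d : 0 < delta -> 0 < fine (leb S) -> 0 < omega R p ->
  alpha S delta d <= delta ^+ p * omega R p / fine (leb S).
Proof.
move=> de0 S0 w0; rewrite /alpha ler_piMr //.
  by apply: ltW; rewrite divr_gt0 // mulr_gt0 // exprn_gt0.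
have d0 : 0 <= d%:R :> R by [].
have q0 : 0 <= p%:R :> R by [].
rewrite ler_pdivrMr ?mul1r; last by rewrite !mulr_gt0 // ltr_wpDl ?addr_ge0 ?mulr_ge0.
apply: ler_pM; rewrite ?mulr_ge0 ?addr_ge0 //; last by lra.
by apply: ler_pM; rewrite ?addr_ge0 //; lra.
Qed.

End thresholds.

Section sublevel_thresholds.
Variables (R : realType) (p : nat) (S : set 'rV[R]_p).
Variables (delta : nat -> R) (d : nat -> nat).
Hypotheses (p0 : (0 < p)%N) (cS : compact S) (clS : closed S).
Hypothesis diamS : 0 < Defs.diam S.
Hypothesis delta0 : forall k, 0 < delta k.
Hypothesis delta_cvg : delta @ \oo --> 0.
Hypothesis d0 : forall k, (0 < d k)%N.
Hypothesis d_dlhs : forall k, dlhs S (delta k) (d k) <= alpha S (delta k) (d k).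

Lemma leb_omega_gt0 : 0 < fine (leb S) /\ 0 < omega R p.
Proof.
apply: (@alpha_gt0_leb_omega _ _ _ (delta 0%N) (d 0%N)) => //.
exact: lt_le_trans (dlhs_gt0 _ p0 _ (d0 0%N)) (d_dlhs 0%N).
Qed.

Let S0 := leb_omega_gt0.1.
Let w0 := leb_omega_gt0.2.

Lemma near_delta_lt (r : R) : 0 < r -> \forall k \near \oo, delta k < r.
Proof.
move=> r0; have /cvgr0Pnorm_lt/(_ r r0) := delta_cvg.
by apply: filterS => k; rewrite gtr0_norm.
Qed.

Lemma near_alpha_lt (r : R) : 0 < r -> \forall k \near \oo, forall m,
  alpha S (delta k) m * fine (leb S) < r.
Proof.
move=> r0; have r1 : 0 < Num.min 1 (r / omega R p) by rewrite lt_min ltr01 divr_gt0.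
apply: filterS (near_delta_lt r1) => k; rewrite lt_min => /andP[k1 kr] m.
apply: (@le_lt_trans _ _ (delta k ^+ p * omega R p)).
  by rewrite -ler_pdivlMr //; exact: alpha_le.
apply: (@le_lt_trans _ _ (delta k * omega R p)); last by rewrite -ltr_pdivlMr.
rewrite ler_pM2r // -[leRHS]expr1 ler_wiXn2l // ?ltW //.
Qed.

Lemma near_degree_geq (N : nat) : \forall k \near \oo, (N <= d k)%N.
Proof.
pose r := expR (- (2 * N%:R)) * (expR 1 / p%:R) ^+ p * fine (leb S).
have E0 : 0 < (expR 1 / p%:R : R) ^+ p by rewrite exprn_gt0 // divr_gt0 ?expR_gt0 ?ltr0n.
have r0 : 0 < r by rewrite !mulr_gt0 ?expR_gt0.
apply: filterS (near_alpha_lt r0) => k Hk; rewrite leqNgt; apply/negP => dN.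
have := Hk (d k); apply/negP; rewrite -leNgt ler_pM2r //.
apply: le_trans (d_dlhs k); apply: le_trans (dlhs_ge (delta0 k) diamS (d0 k)).
rewrite ler_pM2r // -[leLHS]mulr1; apply: ler_pM; rewrite ?expR_ge0 //; last first.
  by rewrite exprn_ege1 // ler1n.
rewrite ler_expR lerN2 -mulrA ler_pM2l //.
apply: (@le_trans _ _ (1 * (d k)%:R)); last by rewrite mul1r ler_nat ltnW.
rewrite ler_wpM2r // ler_pdivrMr ?addr_gt0 // mul1r lerDl ltW //.
Qed.

Lemma near_interior_sublevel (e : R) : 0 < e -> \forall k \near \oo, forall y,
  ball y e `<=` S ->
  ((alpha S (delta k) (d k))%:E <=
   ('C(p + d k, d k))%:R%:E * christoffel (unif_int S) (d k) y)%E.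
Proof.
move=> e0; have r0 : 0 < e ^+ p / p`!%:R by rewrite divr_gt0 ?exprn_gt0 ?ltr0n ?fact_gt0.
apply: filterS (near_alpha_lt r0) => k Hk y yS.
have := christoffel_ge (d k) clS S0 e0 yS.
move=> /(@lee_wpmul2l _ ('C(p + d k, d k))%:R%:E) H.
apply: le_trans (H _); last by rewrite lee_fin.
rewrite -EFinM lee_fin mulrA ler_pdivlMr //; apply: (le_trans (ltW (Hk _))).
have f0 : 0 < p`!%:R :> R by rewrite ltr0n fact_gt0.
have D0 : 0 < (d k).+1%:R ^+ p :> R by rewrite exprn_gt0.
rewrite expr_div_n ler_pdivrMr // mulrA mulrAC ler_pdivlMr // [leRHS]mulrAC mulrC.
rewrite ler_pM2r ?exprn_gt0 // -natrX -natrM ler_nat mulnC.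
exact: expn_leq_fact_bin.
Qed.

Lemma near_exterior_sublevel (e : R) : 0 < e -> \forall k \near \oo, forall z,
  ball z e `<=` ~` S ->
  (('C(p + d k, d k))%:R%:E * christoffel (unif_int S) (d k) z <
   (alpha S (delta k) (d k))%:E)%E.
Proof.
move=> e0; have [t /andP[t0 t1] Ht] := christoffel_le p0 cS clS S0 e0.
pose L := - ln t.
have L0 : 0 < L by rewrite oppr_gt0 ln_lt0 // t0.
have E0 : 0 < (expR 1 / p%:R : R) ^+ p by rewrite exprn_gt0 // divr_gt0 ?expR_gt0 ?ltr0n.
pose C : R := 2 ^+ p / t / (expR 1 / p%:R) ^+ p.
have C0 : 0 < C by rewrite /C !mulr_gt0 ?invr_gt0 ?exprn_gt0 ?divr_gt0 ?expR_gt0 ?ltr0n.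
near=> k.
have dk : delta k < Defs.diam S * L / 4.
  by near: k; apply: near_delta_lt; rewrite divr_gt0 // mulr_gt0.
have Nk : (Num.truncn (2 * C / L) < d k)%N by near: k; exact: near_degree_geq.
move=> z zS; have d0' : 0 < (d k)%:R :> R by rewrite ltr0n.
have dC : 2 * C / L < (d k)%:R.
  apply: (lt_le_trans (truncnS_gt _)); by rewrite ler_nat.
have C1 : C * expR (- (L * (d k)%:R)) <
    expR (- (2 * (delta k / (delta k + Defs.diam S)) * (d k)%:R)).
  apply: (@lt_le_trans _ _ (expR (- (L * (d k)%:R) / 2))); last first.
    rewrite ler_expR mulNr lerN2 [leRHS]mulrAC ler_pM2r //.
    rewrite mulrC -ler_pdivlMr // ler_pdivrMr ?addr_gt0 //.
    apply: (@le_trans _ _ (L / 2 / 2 * Defs.diam S)); first by apply: ltW; lra.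
    by rewrite ler_pM2l ?lerDr ?ltW // !divr_gt0.
  rewrite -ltr_pdivlMr ?expR_gt0 // -expRN -expRD opprK.
  apply: (@lt_le_trans _ _ (L * (d k)%:R / 2)).
    by rewrite ltr_pdivlMr // mulrC mulrC -ltr_pdivrMl // [ltLHS]mulrC [C * 2]mulrC.
  apply: (@le_trans _ _ (1 + L * (d k)%:R / 2)); first by rewrite lerDr.
  apply: (le_trans (expR_ge1Dx _)); rewrite ler_expR; lra.
apply: (@le_lt_trans _ _ (('C(p + d k, d k))%:R%:E * (t ^+ (d k)./2.*2)%:E)%E).
  by apply: lee_wpmul2l; [rewrite lee_fin|exact: Ht].
rewrite -EFinM lte_fin; apply: lt_le_trans (d_dlhs k).
apply: lt_le_trans (dlhs_ge (delta0 k) diamS (d0 k)).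
have tE : t ^+ d k = expR (- (L * (d k)%:R)).
  by rewrite /L -mulNr opprK mulr_natr -lnXn // lnK // posrE exprn_gt0.
apply: (@le_lt_trans _ _ ((2 * (d k)%:R) ^+ p * (t ^+ d k / t))).
  apply: ler_pM => //.
  - by rewrite exprn_ge0 // ltW.
  - rewrite -natrM -natrX ler_nat; apply: (leq_trans (bin_leq_expn _ _)).
    by rewrite leq_exp2r // mul2n -addnn -addn1 leq_add2l.
  - rewrite ler_pdivlMr // -exprSr ler_wiXn2l ?ltW //.
    by rewrite -{1}(odd_double_half (d k)) -addn1 addnC leq_add2l; case: odd.
rewrite exprMn tE mulrAC; move: C1; rewrite /C.
rewrite -(ltr_pM2r (exprn_gt0 p d0')) -(ltr_pM2r E0) => /(le_lt_trans _); apply.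
rewrite le_eqVlt; apply/orP; left; apply/eqP; field.
by rewrite !gt_eqF //.
Unshelve. all: by end_near. Qed.

End sublevel_thresholds.

Theorem theorem3p8 (R : realType) (p : nat) (S : set 'rV[R]_p)
    (delta : nat -> R) (d : nat -> nat) :
  (0 < p)%N ->
  compact S -> S !=set0 -> closure (interior S) = S ->
  (forall k, 0 < delta k) ->
  (forall k, delta k.+1 <= delta k) ->
  delta @ \oo --> 0 ->
  (forall k, [/\ (0 < d k)%N,
     dlhs S (delta k) (d k) <= alpha S (delta k) (d k) &
     forall m, (0 < m)%N -> dlhs S (delta k) m <= alpha S (delta k) m ->
       (d k <= m)%N]) ->
  let Sk := fun k => [set x : 'rV[R]_p |
     (('C(p + d k, d k))%:R%:E * christoffel (unif_int S) (d k) x >=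
        (alpha S (delta k) (d k))%:E)%E] in
  hausdorff (Sk k) S @[k --> \oo] --> 0%:E /\
  hausdorff (bdry (Sk k)) (bdry S) @[k --> \oo] --> 0%:E.
Proof.
move=> p0 cS S0 clS delta0 _ delta_cvg Hd Sk.
have closedS : closed S by rewrite -clS; exact: closed_closure.
have intS : interior S !=set0.
  have [x Sx] := S0; have /(_ _ filterT)[y [yS _]] : closure (interior S) x by rewrite clS.
  by exists y.
have diamS := diam_gt0 p0 cS intS.
have d0 k : (0 < d k)%N by case: (Hd k).
have d_dlhs k : dlhs S (delta k) (d k) <= alpha S (delta k) (d k) by case: (Hd k).
apply: cvg_hausdorff_set_bdry => // e e0.
  exact: near_interior_sublevel.
have H := near_exterior_sublevel p0 cS closedS diamS delta0 delta_cvg d0 d_dlhs e0.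
by apply: filterS H => k Hk z /Hk; rewrite /Sk /= ltNge => /negP.
Qed.
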